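(* Let $p = p(n) \in (0,1]$. Then, with high probability as $n \to \infty$ (i.e. with probability tending to $1$): (i) if $n^{-2} \ll p \ll n^{-1/2}$, then $\log_2 D\big(G(n,p), C^\circlearrowright_{3}\big) = \big(1+o(1)\big)\, p\binom{n}{2}$; (ii) if $p \gg n^{-1/2}$, then $\log_2 D\big(G(n,p), C^\circlearrowright_{3}\big) = \widetilde{\Theta}(n/p)$.
   Context: $G(n,p)$ is the Erdős–Rényi random graph on $n$ vertices in which each pair is an edge independently with probability $p$. An orientation of a graph $G$ is an oriented graph obtained by assigning a direction to every edge of $G$. For an oriented graph $\vec H$, $D(G,\vec H)$ denotes the number of orientations of $G$ that contain no copy of $\vec H$ (as an oriented subgraph). $C^\circlearrowright_{r}$ denotes the directed cycle of length $r$; so $D(G, C^\circlearrowright_{3})$ is the number of orientations of $G$ in which every triangle is transitive. For functions $f,g$, $f \ll g$ (equivalently $g \gg f$) means $f/g \to 0$ as $n\to\infty$. The notation $X = \widetilde{\Theta}(g)$ means that $X$ is bounded above and below by $g$ up to polylogarithmic factors in $n$, i.e. $g/(\log n)^{C} \le X \le g (\log n)^{C}$ for some constant $C$. *)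

(* Defs.v *)
From HB Require Import structures.
From mathcomp Require Import all_boot all_order all_algebra.
From mathcomp Require Import all_classical all_reals all_analysis.
Set Implicit Arguments.
Unset Strict Implicit.
Unset Printing Implicit Defensive.
Import Order.TTheory GRing.Theory Num.Theory.
Import numFieldNormedType.Exports.

Local Open Scope ring_scope.
Local Open Scope classical_set_scope.
Local Open Scope set_scope.

(* A simple graph on the vertex type V is represented by its set of edges,
   a subset of [pairs V]; a digraph is represented by its set of arcs. *)
Definition pairs (V : finType) : {set {set V}} := [set e : {set V} | (#|e| == 2)%N].

(* In particular an oriented graph has no loop (take a.1 = a.2). *)
Definition oriented (V : finType) (A : {set V * V}) : bool :=
  [forall a in A, (a.2, a.1) \notin A].

Definition underlying (V : finType) (A : {set V * V}) : {set {set V}} :=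
  [set [set a.1; a.2] | a in A].

Definition orientation (V : finType) (G : {set {set V}}) (A : {set V * V}) :
    bool :=
  oriented A && (underlying A == G).

(* Copies are not required to be induced. *)
Definition contains_copy (W V : finType) (H : {set W * W}) (A : {set V * V}) :
    bool :=
  [exists f : {ffun W -> V},
    injectiveb f && [forall a in H, (f a.1, f a.2) \in A]].

Definition num_free_orientations (W V : finType) (G : {set {set V}})
    (H : {set W * W}) : nat :=
  #|[set A : {set V * V} | orientation G A && ~~ contains_copy H A]|.

Definition dcycle (r : nat) : {set 'I_r * 'I_r} := [set (i, ordS i) | i : 'I_r].

Section RandomGraph.
Variable R : realType.

Definition Gnp_weight (n : nat) (p : R) (G : {set {set 'I_n}}) : R :=
  \prod_(e in pairs 'I_n) (if e \in G then p else 1 - p).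

Definition Gnp_prob (n : nat) (p : R) (E : pred {set {set 'I_n}}) : R :=
  \sum_(G : {set {set 'I_n}} | (G \subset pairs 'I_n) && E G) Gnp_weight p G.

Definition whp (p : nat -> R) (E : forall n, pred {set {set 'I_n}}) : Prop :=
  Gnp_prob (p n) (E n) @[n --> \oo] --> (1 : R).

Definition much_less (f g : nat -> R) : Prop :=
  f n / g n @[n --> \oo] --> (0 : R).

Definition log2 (x : R) : R := ln x / ln 2.

(* With high probability X(G(n,p)) = (1 + o(1)) g(n). *)
Definition whp_asymp (p : nat -> R) (X : forall n, {set {set 'I_n}} -> R)
    (g : nat -> R) : Prop :=
  forall eps : R, 0 < eps ->
    whp p (fun n G => `|X n G - g n| <= eps * g n).

(* With high probability X(G(n,p)) = Theta(g(n)) up to polylogarithmic factors;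
   the exponent C does not depend on n. *)
Definition whp_polylog (p : nat -> R) (X : forall n, {set {set 'I_n}} -> R)
    (g : nat -> R) : Prop :=
  exists C : R,
    whp p (fun n G => (g n / ln n%:R `^ C <= X n G) &&
                      (X n G <= g n * ln n%:R `^ C)).

End RandomGraph.

(* Main.v *)
(** Upper bound for dense [p]: reveal the vertices one at a time. When all triangles are
    transitive, the out-neighbours of a new vertex inside its set [U] of earlier neighbours are
    closed under the arcs already placed in [U]. If any [a] vertices span an edge (with high
    probability this holds for some [a] of order [log n / p]), then some [u] in [U] has at least
    [|U| / 4a] in-neighbours and as many out-neighbours in [U]; deciding whether [u] belongs to
    the closed set settles one of the two neighbourhoods. Hence a closed set is found after
    [O(a log n)] binary questions, and each vertex contributes at most [(2n)^(4a)] choices.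

    Lower bounds: cut the vertices into intervals, orient all edges forward, then flip
    arbitrarily the edges inside an interval that lie in no triangle inside that interval; no
    cyclic triangle arises. A single interval handles the sparse regime, and intervals of length
    [1 / (p^2 log n)] the dense one: there the expected number of triangles inside the
    intervals is much smaller than that of edges. *)
Require Import Defs.
From mathcomp Require Import all_boot all_order all_algebra.
From mathcomp Require Import zify.
Set Implicit Arguments.
Unset Strict Implicit.

(** * Closed sets of a relation *)

(** In-degrees and out-degrees have the same sum over [W], so some vertex also has fewer than [d]
    out-neighbours. Keep it, delete it together with its neighbours, at most [2 * d] vertices in
    all, and repeat. *)
Lemma independent_of_bounded_indegree (V : finType) (r : rel V) (d : nat) (W : {set V}) :
  irreflexive r -> (forall v, v \in W -> #|[set w in W | r w v]| < d) ->
  exists I : {set V}, [/\ I \subset W, #|W| <= 2 * d * #|I| &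
    {in I &, forall x y, ~~ r x y}].
Proof.
move=> irr; have [n] := ubnP #|W|; elim: n W => // n IHn W ltWn degW.
have [->|/set0Pn[w0 w0W]] := eqVneq W set0.
  by exists set0; split; rewrite ?cards0 // => x y; rewrite inE.
have [v vW outv] : exists2 v, v \in W & #|[set w in W | r v w]| < d.
  apply/exists_inP; apply: contraT => /exists_inPn noout.
  have eqdeg : \sum_(v in W) #|[set w in W | r v w]| =
               \sum_(v in W) #|[set w in W | r w v]|.
    have cardE (f : pred V) : #|[set w in W | f w]| = \sum_(w in W) f w.
      by rewrite -sum1_card big_mkcond [RHS]big_mkcond; apply: eq_bigr => i _; rewrite inE; case: (i \in W); case: (f i).
    under eq_bigr => v _ do rewrite cardE.
    under [RHS]eq_bigr => v _ do rewrite cardE.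
    exact: exchange_big.
  have : \sum_(v in W) #|[set w in W | r w v]| < \sum_(v in W) #|[set w in W | r v w]|.
    rewrite (bigD1 w0) //= [X in _ < X](bigD1 w0) //= -addSn leq_add //.
      by apply: leq_trans (degW _ w0W) _; rewrite leqNgt noout.
    apply: leq_sum => v /andP[vW _].
    by apply: ltnW; apply: leq_trans (degW _ vW) _; rewrite leqNgt noout.
  by rewrite eqdeg ltnn.
pose N := v |: ([set w in W | r v w] :|: [set w in W | r w v]).
have subN : N \subset W.
  by apply/subsetP=> w; rewrite !inE => /orP[/eqP->//|/orP[]/andP[]].
have cardN : #|N| <= 2 * d.
  have := degW _ vW; have := cardsU1 v ([set w in W | r v w] :|: [set w in W | r w v]).
  have [+ _] := leq_card_setU [set w in W | r v w] [set w in W | r w v].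
  rewrite -/N; have := leq_b1 (v \notin [set w in W | r v w] :|: [set w in W | r w v]).
  by set b := nat_of_bool _; lia.
have cardD : #|W| = #|N| + #|W :\: N| by rewrite -(cardsID N W) (setIidPr subN).
have vN : v \in N by rewrite !inE eqxx.
have N0 : 0 < #|N| by apply/card_gt0P; exists v.
case: (IHn (W :\: N)) => [|x|I [IW cardI indI]]; first by lia.
- rewrite inE => /andP[_ xW]; apply: leq_ltn_trans (degW _ xW).
  by apply/subset_leq_card/subsetP => w; rewrite !inE => /andP[/andP[_ ->] ->].
have INr x : x \in I -> ~~ r v x && ~~ r x v /\ x != v.
  move/(subsetP IW); rewrite !inE !negb_or => /andP[/andP[-> h] xW].
  by move: h; rewrite xW /= => ->.
exists (v |: I); split.
- rewrite subUset sub1set vW; apply: subset_trans IW _; exact: subsetDl.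
- have -> : #|v |: I| = 1 + #|I|.
    by rewrite cardsU1; case: (boolP (v \in I)) => // /INr[_]; rewrite eqxx.
  nia.
- move=> x y; rewrite !inE => /orP[/eqP->|xI] /orP[/eqP->|yI]; rewrite ?irr //.
  + by case/INr: yI => /andP[].
  + by case/INr: xI => /andP[].
  + exact: indI.
Qed.

(** When no triangle is cyclic, these are the candidates for the out-neighbourhood in [U] of a
    vertex joined to all of [U]. *)
Definition closed_sets (V : finType) (r : rel V) (U : {set V}) : {set {set V}} :=
  [set S : {set V} | (S \subset U) &&
    [forall x in S, forall y in U, r x y ==> (y \in S)]].

(** Put [d := #|U| %/ (4 * a)]. If at least half of [U] had in-degree below [d], these vertices
    would contain an independent set of size at least [#|U| / (4 * d) >= a]. Reversing [r] gives the
    same for out-degrees, so the two exceptional sets do not cover [U]. *)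
Lemma exists_balanced_vertex (V : finType) (r : rel V) (a : nat) (U : {set V}) :
  irreflexive r -> 0 < a -> 4 * a <= #|U| ->
  (forall I : {set V}, I \subset U -> a <= #|I| ->
    exists x y, [/\ x \in I, y \in I & r x y]) ->
  exists u, [/\ u \in U, #|U| %/ (4 * a) <= #|[set w in U | r u w]|
    & #|U| %/ (4 * a) <= #|[set w in U | r w u]| ].
Proof.
move=> irr a0 leaU hI; set d := #|U| %/ (4 * a).
have d0 : 0 < d by rewrite divn_gt0 //; lia.
have dU : d * (4 * a) <= #|U| by exact: leq_divM.
have key (q : rel V) (W : {set V}) : irreflexive q ->
    (forall I : {set V}, I \subset U -> a <= #|I| ->
      exists x y, [/\ x \in I, y \in I & q x y]) ->
    W \subset U -> (forall v, v \in W -> #|[set w in U | q w v]| < d) ->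
    2 * #|W| < #|U|.
  move=> irq hq WU degW; rewrite ltnNge; apply/negP => UW.
  have [|I [IW cardI indI]] := @independent_of_bounded_indegree V q d W irq.
    move=> v /degW; apply: leq_ltn_trans.
    apply/subset_leq_card/subsetP => w; rewrite !inE => /andP[wW ->].
    by rewrite (subsetP WU).
  have aI : a <= #|I| by rewrite leqNgt; apply/negP => ltIa; nia.
  have [x [y [xI yI]]] := hq I (subset_trans IW WU) aI.
  exact/negP/indI.
have /exists_inP[u uU /andP[]] :
    [exists u in U, (d <= #|[set w in U | r u w]|) && (d <= #|[set w in U | r w u]|)].
  apply: contraT => /exists_inPn no.
  have := key r [set u in U | #|[set w in U | r w u]| < d] irr hI.
  have := key (fun x y => r y x) [set u in U | #|[set w in U | r u w]| < d] irr.
  set W1 := finset _; set W2 := finset _ => h1 h2.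
  have {}h1 : 2 * #|W1| < #|U|.
    apply: h1 => [I IU aI||v]; last by rewrite inE => /andP[].
      by have [x [y [xI yI rxy]]] := hI I IU aI; exists y, x.
    by apply/subsetP => x; rewrite inE => /andP[].
  have {}h2 : 2 * #|W2| < #|U|.
    apply: h2 => [|v]; last by rewrite inE => /andP[].
    by apply/subsetP => x; rewrite inE => /andP[].
  have : U \subset W1 :|: W2.
    apply/subsetP => u uU; rewrite !inE uU /=.
    by move: (no u uU); rewrite negb_and -!ltnNge.
  move/subset_leq_card; have [+ _] := leq_card_setU W1 W2; lia.
by exists u.
Qed.

(** Bernoulli: with [x = m - d], [(x + d)^k >= x^k + k * d * x^(k-1)], and [k * d >= m >= x]. If
    [m <= d], the truncated difference is [0]. *)
Lemma double_expn_le (k m d : nat) : 0 < k -> m <= k * d -> 2 * (m - d) ^ k <= m ^ k.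
Proof.
case: k => // k _; have [|ltmd] := leqP m d.
  by rewrite -subn_eq0 => /eqP->; rewrite exp0n // muln0.
rewrite -{3 1}(subnK (ltnW ltmd)); set x := m - d => h.
have bern j : x ^ j.+1 + j.+1 * d * x ^ j <= (x + d) ^ j.+1.
  elim: j => [|j IHj]; first by rewrite !expn1 expn0; lia.
  rewrite [(x + d) ^ _]expnS.
  apply: leq_trans (leq_mul (leqnn (x + d)) IHj).
  rewrite (expnS x j.+1) (expnS x j); nia.
apply: leq_trans (bern k); rewrite !expnS; nia.
Qed.

(** For a balanced vertex [u], a closed set through [u] contains all out-neighbours of [u], and one
    avoiding [u] avoids all in-neighbours. The rest of the set is closed in what remains of [U], so
    by induction each case accounts for at most half of the bound. The factor [2 ^ (4 * a)] covers
    the sets [U] too small for a balanced vertex. *)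
Lemma card_closed_sets (V : finType) (r : rel V) (a : nat) (U : {set V}) :
  irreflexive r -> 0 < a ->
  (forall I : {set V}, I \subset U -> a <= #|I| ->
    exists x y, [/\ x \in I, y \in I & r x y]) ->
  #|closed_sets r U| <= 2 ^ (4 * a) * #|U|.+1 ^ (4 * a).
Proof.
move=> irr a0; have [n] := ubnP #|U|; elim: n U => // n IHn U ltUn hI.
have [ltUa|leaU] := ltnP #|U| (4 * a).
  apply: (@leq_trans (2 ^ (4 * a))); last by rewrite leq_pmulr // expn_gt0.
  apply: (@leq_trans #|powerset U|); last by rewrite card_powerset leq_exp2l // ltnW.
  by apply/subset_leq_card/subsetP => S; rewrite !inE => /andP[].
have [u [uU outu inu]] := exists_balanced_vertex irr a0 leaU hI.
pose O := u |: [set w in U | r u w].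
pose N := u |: [set w in U | r w u].
have cardO : #|O| = #|[set w in U | r u w]|.+1 by rewrite cardsU1 inE irr andbF.
have cardN : #|N| = #|[set w in U | r w u]|.+1 by rewrite cardsU1 inE irr andbF.
have subO : O \subset U.
  by apply/subsetP => w; rewrite !inE => /orP[/eqP->//|/andP[]].
have subN : N \subset U.
  by apply/subsetP => w; rewrite !inE => /orP[/eqP->//|/andP[]].
(* As [#|X|] exceeds the rounded-down quotient, [#|U|.+1 <= 4 * a * #|X|], which is the hypothesis
   of [double_expn_le]. *)
have bound (X : {set V}) : X \subset U -> #|U| %/ (4 * a) < #|X| ->
    2 * #|closed_sets r (U :\: X)| <= 2 ^ (4 * a) * #|U|.+1 ^ (4 * a).
  move=> XU ltX; have cU : #|U| = #|X| + #|U :\: X|.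
    by rewrite -(cardsID X U) (setIidPr XU).
  have h : #|closed_sets r (U :\: X)| <= 2 ^ (4 * a) * #|U :\: X|.+1 ^ (4 * a).
    have X0 : 0 < #|X| by apply: leq_trans ltX.
    apply: IHn => [|I IX]; first by clear ltX; lia.
    by apply: hI; apply: subset_trans IX (subsetDl _ _).
  have := @double_expn_le (4 * a) #|U|.+1 #|X|.
  have -> : #|U|.+1 - #|X| = #|U :\: X|.+1 by rewrite cU -addnS addKn.
  have ltU4 : #|U| < (#|U| %/ (4 * a)).+1 * (4 * a) by rewrite ltn_ceil // muln_gt0.
  move=> dbl.
  apply: leq_trans (leq_mul (leqnn 2) h) _; rewrite mulnCA leq_mul //.
  apply: dbl; first by rewrite muln_gt0.
  by apply: leq_trans ltU4 _; rewrite mulnC leq_mul.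
have h1 := bound O subO; have h2 := bound N subN.
have {}h1 : 2 * #|closed_sets r (U :\: O)| <= 2 ^ (4 * a) * #|U|.+1 ^ (4 * a).
  by apply: h1; rewrite cardO ltnS.
have {}h2 : 2 * #|closed_sets r (U :\: N)| <= 2 ^ (4 * a) * #|U|.+1 ^ (4 * a).
  by apply: h2; rewrite cardN ltnS.
suff : #|closed_sets r U| <= #|closed_sets r (U :\: O)| + #|closed_sets r (U :\: N)| by lia.
rewrite -(cardsID [set S : {set V} | u \in S]).
have closedP S : S \in closed_sets r U ->
    S \subset U /\ (forall x y, x \in S -> y \in U -> r x y -> y \in S).
  rewrite inE => /andP[SU /forall_inP h]; split=> // x y xS yU.
  by move: (h x xS) => /forall_inP/(_ y yU)/implyP.
apply: leq_add.
- rewrite -(card_in_imset (f := fun S => S :\: O)).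
    apply/subset_leq_card/subsetP => _ /imsetP[S /setIP[/closedP[SU cl] _] ->].
    rewrite inE setSD //=; apply/forall_inP => x; rewrite !inE => /andP[xO xS].
    apply/forall_inP => y; rewrite !inE => /andP[-> yU]; apply/implyP; exact: cl.
  move=> S T /setIP[/closedP[_ clS] uS] /setIP[/closedP[_ clT] uT] eqST.
  rewrite !inE in uS uT.
  (* All closed sets through [u] have the same trace on [O], so removing [O] loses no
     information. *)
  have OS (Z : {set V}) : u \in Z -> (forall x y, x \in Z -> y \in U -> r x y -> y \in Z) -> Z :&: O = O.
    move=> uZ cl; apply/setIidPr/subsetP => w; rewrite !inE => /orP[/eqP->//|/andP[wU ruw]].
    exact: cl ruw.
  by rewrite -(setID S O) -(setID T O) eqST !OS.
- have disN S : S \in closed_sets r U :\: [set S : {set V} | u \in S] -> S :&: N = set0.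
    case/setDP => /closedP[SU cl]; rewrite inE => uS; apply/setP => w; rewrite !inE.
    apply/negbTE/negP => /andP[wS /orP[/eqP wu|/andP[wU rwu]]].
      by move: uS; rewrite -wu wS.
    by move: uS; rewrite (cl w u).
  rewrite -(card_in_imset (f := fun S => S :\: N)).
    apply/subset_leq_card/subsetP => _ /imsetP[S /setDP[/closedP[SU cl] _] ->].
    rewrite inE setSD //=; apply/forall_inP => x; rewrite !inE => /andP[xO xS].
    apply/forall_inP => y; rewrite !inE => /andP[-> yU]; apply/implyP; exact: cl.
  move=> S T hS hT eqST.
  by rewrite -(setID S N) -(setID T N) eqST !disN.
Qed.

(** * Orientations without cyclic triangle *)

Lemma leq_card_inj_in (T T' : finType) (f : T -> T') (X : {set T}) (Y : {set T'}) :
  {in X, forall x, f x \in Y} -> {in X &, injective f} -> #|X| <= #|Y|.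
Proof.
move=> fXY /card_in_imset <-.
by apply/subset_leq_card/subsetP => _ /imsetP[x /fXY + ->].
Qed.

Lemma card_le_fibers (T T' : finType) (f : T -> T') (X : {set T}) (Y : {set T'}) (M : nat) :
  {in X, forall x, f x \in Y} ->
  {in Y, forall y, #|[set x in X | f x == y]| <= M} -> #|X| <= M * #|Y|.
Proof.
move=> fXY fibM; rewrite -sum1_card (partition_big f (mem Y)) //=.
rewrite mulnC -sum_nat_const; apply: leq_sum => y yY.
by apply: leq_trans (fibM y yY); rewrite sum1dep_card.
Qed.

Lemma set2_inj (T : finType) (a b x y : T) :
  [set a; b] = [set x; y] -> (a = x /\ b = y) \/ (a = y /\ b = x).
Proof.
move=> eq_ab.
have: a \in [set x; y] by rewrite -eq_ab set21.
have: b \in [set x; y] by rewrite -eq_ab set22.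
have: x \in [set a; b] by rewrite eq_ab set21.
have: y \in [set a; b] by rewrite eq_ab set22.
rewrite !inE => /pred2P[]-> /pred2P[]-> /pred2P[]e1 /pred2P[]e2; by intuition congruence.
Qed.

Lemma set2_pairs (V : finType) (x y : V) : ([set x; y] \in pairs V) = (x != y).
Proof. by rewrite inE cards2; case: (x != y). Qed.

(* The first condition encodes both antisymmetry and the underlying graph: it
   says that each edge of [G] inside [W] carries one arc, and other pairs none. *)
Definition transitive_orientations (V : finType) (G : {set {set V}}) (W : {set V}) :
    {set {set V * V}} :=
  [set A : {set V * V} |
    [forall x, forall y, ((x, y) \in A) + ((y, x) \in A) ==
       ([&& x \in W, y \in W & [set x; y] \in G] : nat)] &&
    [forall x, forall y, forall z,
       ~~ [&& (x, y) \in A, (y, z) \in A & (z, x) \in A]]].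

Lemma transitive_orientationsP (V : finType) (G : {set {set V}}) (W : {set V})
    (A : {set V * V}) :
  reflect ((forall x y, ((x, y) \in A) + ((y, x) \in A) =
             ([&& x \in W, y \in W & [set x; y] \in G] : nat)) /\
           (forall x y z, (x, y) \in A -> (y, z) \in A -> (z, x) \notin A))
    (A \in transitive_orientations G W).
Proof.
rewrite inE; apply: (iffP andP) => -[h1 h2]; split.
- by move=> x y; apply/eqP; move/forallP/(_ x)/forallP/(_ y): h1.
- move=> x y z xy yz; move/forallP/(_ x)/forallP/(_ y)/forallP/(_ z): h2.
  by rewrite xy yz.
- by do 2!apply/forallP => ?; apply/eqP.
- by do 3!apply/forallP => ?; apply/and3P => -[/h2 h /h]/negP.
Qed.

(** An oriented graph has no loop, so the three vertices are automatically distinct and the map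
    sending the cycle to them is injective. *)
Lemma contains_dcycle3P (V : finType) (A : {set V * V}) : oriented A ->
  reflect (exists x y z, [/\ (x, y) \in A, (y, z) \in A & (z, x) \in A])
    (contains_copy (dcycle 3) A).
Proof.
move=> /forall_inP orA; apply: (iffP existsP) => [[f /andP[_ /forall_inP h]]|].
  have hf i : (f i, f (ordS i)) \in A by apply: (h (i, ordS i)); apply/imsetP; exists i.
  exists (f ord0), (f (ordS ord0)), (f (ordS (ordS ord0))); split => //.
  by have := hf (ordS (ordS ord0)); rewrite [ordS (ordS (ordS _))](_ : _ = ord0) //; apply: val_inj.
case=> x [y [z [xy yz zx]]].
have irr u : (u, u) \notin A by apply/negP => uu; have /negP := orA _ uu; apply.
have neq u w : (u, w) \in A -> u != w.
  by move=> uw; apply: contraTneq uw => ->; apply: irr.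
have [[xy' yz'] zx'] := (neq _ _ xy, neq _ _ yz, neq _ _ zx).
exists ([ffun i : 'I_3 => tnth [tuple x; y; z] i] : {ffun 'I_3 -> V}); apply/andP; split.
  apply/injectiveP => i j; rewrite !ffunE !(tnth_nth x).
  case: i j => [[|[|[|]]]] // ? [[|[|[|]]]] //= ? eqf; try exact: val_inj;
    by move: xy' yz' zx'; rewrite eqf eqxx.
apply/forall_inP => _ /imsetP[i _ ->]; rewrite !ffunE !(tnth_nth x) /=.
by case: i => [[|[|[|]]]].
Qed.

(** The right-hand form makes sense for every vertex subset, as an induction over vertices
    requires. *)
Lemma num_free_dcycle3E (V : finType) (G : {set {set V}}) : G \subset pairs V ->
  num_free_orientations G (dcycle 3) = #|transitive_orientations G [set: V]|.
Proof.
move=> Gp; apply: eq_card => A; rewrite inE; apply/andP/transitive_orientationsP.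
  move=> [/andP[orA /eqP undA] nocopy]; split=> [x y|x y z xy yz]; last first.
    apply: contra nocopy => zx; apply/contains_dcycle3P => //.
    by exists x, y, z.
  rewrite !inE /= -undA.
  have -> : ([set x; y] \in underlying A) = ((x, y) \in A) || ((y, x) \in A).
    apply/imsetP/orP => [[[a b] ab /= /set2_inj[[-> ->]|[-> ->]]]|[h|h]];
      [by left|by right|by exists (x, y)|by exists (y, x); rewrite //= setUC].
  move/forall_inP: orA => orA.
  case: (boolP ((x, y) \in A)) => [/orA/negbTE /= ->|_] //.
move=> [h tr].
have orA : oriented A.
  apply/forall_inP => -[x y] /= xy; apply/negP => yx; have := h x y.
  by rewrite xy yx; case: [&& _, _ & _].
split; last by apply/contains_dcycle3P => // -[x [y [z [xy yz]]]]; apply/negP; exact: tr yz.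
rewrite /orientation orA; apply/eqP/setP => e; apply/imsetP/idP.
  move=> [[x y] xy ->] /=; have := h x y; rewrite xy !inE /=.
  by case: (_ \in G); case: (_ \in A).
move=> eG; have := subsetP Gp e eG; rewrite inE => /cards2P[x [y [_ eE]]].
have := h x y; rewrite !inE /= -eE eG.
case: (boolP ((x, y) \in A)) => [xy _|_]; first by exists (x, y).
case: (boolP ((y, x) \in A)) => // yx _; exists (y, x) => //=.
by rewrite eE setUC.
Qed.

(** Group the orientations by their restriction [A0] to [W]. Given [A0], only the out-neighbourhood
    of [v] is free, and it is closed under [A0] in [U]: the arcs [(v, x)] and [(x, y)] rule out
    [(y, v)], so the edge between [v] and [y] is directed out of [v]. *)
Lemma card_transitive_orientations_setU1 (V : finType) (G : {set {set V}}) (W : {set V})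
    (v : V) (a : nat) :
  G \subset pairs V -> v \notin W -> 0 < a ->
  (forall I : {set V}, a <= #|I| -> exists x y, [/\ x \in I, y \in I & [set x; y] \in G]) ->
  #|transitive_orientations G (v |: W)| <=
    (2 * #|V|) ^ (4 * a) * #|transitive_orientations G W|.
Proof.
move=> Gp vW a0 hI.
have irrG x : [set x; x] \notin G.
  by apply/negP => /(subsetP Gp); rewrite set2_pairs eqxx.
apply: (@card_le_fibers _ _ (fun A => A :&: setX W W)) => [A|A0 hA0].
  move=> /transitive_orientationsP[h tr]; apply/transitive_orientationsP; split.
    move=> x y; have := h x y; rewrite !inE /=.
    by case: (x \in W); case: (y \in W); rewrite ?andbF ?orbT ?andbT.
  by move=> x y z; rewrite !inE => /andP[xy _] /andP[yz _]; rewrite (negbTE (tr _ _ _ xy yz)).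
pose U := [set u in W | [set v; u] \in G].
pose r := [rel x y | (x, y) \in A0].
move/transitive_orientationsP: (hA0) => [h0 _].
have irr : irreflexive r.
  move=> x /=; have := h0 x x; rewrite (negbTE (irrG x)) !andbF.
  by case: (_ \in A0).
apply: (@leq_trans #|closed_sets r U|); last first.
  apply: leq_trans (card_closed_sets irr a0 _) _.
    move=> I IU /hI[x [y [xI yI xyG]]]; have := h0 x y; rewrite xyG.
    have IW w : w \in I -> w \in W by move/(subsetP IU); rewrite inE => /andP[].
    rewrite !IW //=; case: (boolP ((x, y) \in A0)) => [xy _|_]; first by exists x, y.
    by case: (boolP ((y, x) \in A0)) => // yx _; exists y, x.
  (* [v] lies outside [U], hence [#|U|.+1 <= #|V|]. *)
  rewrite expnMn leq_mul // leq_exp2r ?muln_gt0 //.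
  rewrite -cardsT; apply: proper_card; apply/properP; split; first exact: subsetT.
  by exists v; rewrite !inE ?(negbTE vW).
have fibP A : A \in [set A in transitive_orientations G (v |: W) | A :&: setX W W == A0] ->
  [/\ forall x y, ((x, y) \in A) + ((y, x) \in A) =
        ([&& x \in v |: W, y \in v |: W & [set x; y] \in G] : nat),
      forall x y z, (x, y) \in A -> (y, z) \in A -> (z, x) \notin A &
      forall x y, x \in W -> y \in W -> ((x, y) \in A) = ((x, y) \in A0)].
  case/setIdP => /transitive_orientationsP[h tr] /eqP <-; split=> // x y xW yW.
  rewrite in_setI in_setX /= xW yW !andbT; reflexivity.
refine (leq_card_inj_in (f := fun A : {set V * V} => [set u | (v, u) \in A]) _ _).
  move=> A /fibP[h tr hA].
  rewrite inE; apply/andP; split.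
    apply/subsetP => u; rewrite !inE => vu; have := h v u; rewrite vu !inE eqxx /=.
    have [-> |_ /=] := eqVneq u v; first by rewrite (negbTE (irrG v)) andbF.
    by case: (u \in W); case: (_ \in G); case: (_ \in A).
  apply/forall_inP => x; rewrite inE => vx; apply/forall_inP => y; rewrite [y \in U]inE => /andP[yW vyG].
  apply/implyP; rewrite inE /= => xy.
  have xW : x \in W by have := h0 x y; rewrite xy yW; case: (x \in W).
  have := h v y; rewrite !inE eqxx yW orbT vyG /=.
  have yv : (y, v) \notin A by apply: (tr _ _ _ vx); rewrite hA.
  by rewrite (negbTE yv) addn0; case: (_ \in A).
move=> A B /fibP[hA _ eA] /fibP[hB _ eB] /setP eqAB.
have {}eqAB u : ((v, u) \in A) = ((v, u) \in B) by have := eqAB u; rewrite !inE.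
have out (C : {set V * V}) x y : (forall x y, ((x, y) \in C) + ((y, x) \in C) =
        ([&& x \in v |: W, y \in v |: W & [set x; y] \in G] : nat)) ->
    (x \notin v |: W) || (y \notin v |: W) -> (x, y) \in C = false.
  move=> /(_ x y) hC /orP[/negbTE h|/negbTE h]; move: hC; rewrite h ?andbF;
  by case: (_ \in C).
apply/setP => -[x y].
case: (boolP ((x \in v |: W) && (y \in v |: W))); last first.
  by rewrite negb_and => o; rewrite !out.
rewrite !in_setU1 => /andP[/orP[/eqP->//|xW] /orP[/eqP->|yW]]; last by rewrite eA ?eB.
(* Each edge carries exactly one arc, so the arcs into [v] follow from those out of [v]. *)
have := hA x v; rewrite -hB eqAB => /eqP; rewrite eqn_add2r.
by case: (_ \in A); case: (_ \in B).
Qed.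

Lemma card_transitive_orientations_le (V : finType) (G : {set {set V}}) (a : nat) (W : {set V}) :
  G \subset pairs V -> 0 < a ->
  (forall I : {set V}, a <= #|I| -> exists x y, [/\ x \in I, y \in I & [set x; y] \in G]) ->
  #|transitive_orientations G W| <= (2 * #|V|) ^ (4 * a * #|W|).
Proof.
move=> Gp a0 hI; have [n] := ubnP #|W|; elim: n W => // n IHn W ltW.
have [->|[v vW]] := set_0Vmem W.
  rewrite cards0 muln0 expn0 -(cards1 (set0 : {set V * V})).
  apply/subset_leq_card/subsetP => A /transitive_orientationsP[h _].
  rewrite inE; apply/eqP/setP => -[x y]; have := h x y; rewrite !inE /=.
  by case: (_ \in A).
rewrite -(setD1K vW); have vD : v \notin W :\ v by rewrite !inE eqxx.
apply: leq_trans (card_transitive_orientations_setU1 Gp vD a0 hI) _.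
rewrite cardsU1 vD mulnDr muln1 expnD leq_mul //; apply: IHn.
by move: ltW; rewrite (cardsD1 v W) vW.
Qed.

(** An orientation is recovered from the set of edges that it directs upward in the order given by
    [rk]. *)
Lemma card_transitive_orientations_le_exp (V : finType) (G : {set {set V}}) (n : nat) (rk : V -> 'I_n) :
  injective rk -> G \subset pairs V ->
  #|transitive_orientations G [set: V]| <= 2 ^ #|G|.
Proof.
move=> rk_inj Gp; rewrite -card_powerset.
pose f (A : {set V * V}) := [set [set a.1; a.2] | a in A & (rk a.1 < rk a.2)%N].
have fE A x y : A \in transitive_orientations G [set: V] -> rk x < rk y ->
    ([set x; y] \in f A) = ((x, y) \in A).
  move=> /transitive_orientationsP[h _] ltxy; apply/imsetP/idP => [[[c d]]|xy].
    rewrite inE /= => /andP[cd ltcd] /set2_inj[[-> ->]//|[xd yc]].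
    by move: ltxy; rewrite xd yc ltnNge ltnW.
  by exists (x, y); rewrite // inE xy.
apply: (leq_card_inj_in (f := f)) => [A hA|].
  rewrite inE.
  apply/subsetP => _ /imsetP[[x y] + ->]; rewrite inE /= => /andP[xy _].
  move/transitive_orientationsP: hA => [/(_ x y) + _].
  by rewrite xy !inE /=; case: (_ \in G); case: (_ \in A).
move=> A B hA hB eqf; apply/setP => -[x y].
move/transitive_orientationsP: (hA) => [/(_ x y) eA _].
move/transitive_orientationsP: (hB) => [/(_ x y) eB _].
move: eA; rewrite -eB => eqAB.
case: (ltngtP (rk x) (rk y)) => [lt|gt|/val_inj/rk_inj eqxy].
- by rewrite -(fE A) // -(fE B) // eqf.
- have yx : ((y, x) \in A) = ((y, x) \in B) by rewrite -(fE A) // -(fE B) // eqf.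
  by move/eqP: eqAB; rewrite yx eqn_add2r; case: (_ \in A); case: (_ \in B).
- by move: eqAB; rewrite eqxy; case: (_ \in A); case: (_ \in B).
Qed.

(** * Lower bound: flipping edges inside blocks *)

Definition flip_orientation (n : nat) (G S : {set {set 'I_n}}) : {set 'I_n * 'I_n} :=
  [set a | ([set a.1; a.2] \in G) && ((a.1 < a.2) (+) ([set a.1; a.2] \in S))].

(** The values of [b] label the blocks. Such an edge may still lie in triangles of [G] whose third
    vertex is in another block. *)
Definition triangle_free_edges (n : nat) (b : nat -> nat) (G : {set {set 'I_n}}) :
    {set {set 'I_n}} :=
  [set e in G | [forall x in e, forall y in e, b x == b y] &&
    ~~ [exists z, [&& z \notin e, [forall x in e, b x == b z] &
        [forall x in e, [set x; z] \in G]]]].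

(** Along every arc [b] does not decrease, so a cyclic triangle stays in one block. Then none of its
    edges is flipped and all three arcs go forward, which is absurd. The flipped set can be read off
    from the orientation. *)
Lemma card_transitive_orientations_ge (n : nat) (b : nat -> nat) (G : {set {set 'I_n}}) :
  {homo b : i j / i <= j} -> G \subset pairs 'I_n ->
  2 ^ #|triangle_free_edges b G| <= #|transitive_orientations G [set: 'I_n]|.
Proof.
move=> mono_b Gp; rewrite -card_powerset; apply: (leq_card_inj_in (f := flip_orientation G)).
  move=> S; rewrite inE => SF.
  apply/transitive_orientationsP; split=> [x y|x y z].
    rewrite !inE /= [[set y; x]]setUC.
    case: (boolP ([set x; y] \in G)) => //= /(subsetP Gp); rewrite set2_pairs => neq.
    by case: ltngtP => [||/val_inj eqxy]; [case: (_ \in S)..|rewrite eqxy eqxx in neq].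
  have le_b u w : (u, w) \in flip_orientation G S -> b u <= b w.
    rewrite inE /= => /andP[uwG]; case: (boolP ([set u; w] \in S)) => [|_].
      move/(subsetP SF); rewrite inE => /and3P[_ /forall_inP h _] _.
      by have /forall_inP/(_ w)/(_ _)/eqP-> := h u (set21 _ _); rewrite ?set22.
    by rewrite addbF => /ltnW/mono_b.
  move=> xy yz; apply/negP => zx.
  have [bxy byz bzx] := And3 (le_b _ _ xy) (le_b _ _ yz) (le_b _ _ zx).
  have eq1 : b y = b x by apply/eqP; rewrite eqn_leq bxy (leq_trans byz).
  have eq2 : b z = b x by apply/eqP; rewrite eqn_leq bzx (leq_trans bxy).
  have noS u v w : (u, v) \in flip_orientation G S -> (v, w) \in flip_orientation G S ->
      (w, u) \in flip_orientation G S -> b u = b w -> b v = b w -> u < v.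
    rewrite !inE /= => /andP[uvG +] /andP[vwG _] /andP[wuG _] buw bvw.
    case: (boolP ([set u; v] \in S)) => [|_]; last by rewrite addbF.
    move/(subsetP SF); rewrite inE => /and3P[_ _ /existsP[]].
    exists w; apply/and3P; split.
    - rewrite !inE negb_or; apply/andP; split.
        by move/(subsetP Gp): wuG; rewrite set2_pairs.
      by move/(subsetP Gp): vwG; rewrite set2_pairs eq_sym.
    - by apply/forall_inP => t; rewrite !inE => /pred2P[]->; rewrite ?buw ?bvw.
    - by apply/forall_inP => t; rewrite !inE => /pred2P[]->; rewrite ?vwG // setUC.
  have := noS _ _ _ xy yz zx; have := noS _ _ _ yz zx xy; have := noS _ _ _ zx xy yz.
  rewrite eq1 eq2 => /(_ erefl erefl) h1 /(_ erefl erefl) h2 /(_ erefl erefl) h3.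
  by have := ltn_trans h3 (ltn_trans h2 h1); rewrite ltnn.
move=> S T; rewrite !inE => SF TF eqST.
have sub (P Q : {set {set 'I_n}}) : P \subset triangle_free_edges b G ->
    flip_orientation G P = flip_orientation G Q -> P \subset Q.
  move=> PF eqPQ; apply/subsetP => e eP.
  have eG : e \in G by move/(subsetP PF): eP; rewrite inE => /andP[].
  move: (eG) => /(subsetP Gp); rewrite inE => /cards2P[x [y [neq eE]]]; subst e.
  move/setP/(_ (x, y)): eqPQ; rewrite !inE /= eG eP /=.
  by case: (_ < _); case: (_ \in Q).
by apply/eqP; rewrite eqEsubset (sub S T) // (sub T S).
Qed.

(** * Edges and triangles inside blocks *)

Definition block_pairs (n : nat) (b : nat -> nat) : {set {set 'I_n}} :=
  [set e in pairs 'I_n | [forall x in e, forall y in e, b x == b y]].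

Definition block_triangle (n : nat) (e : {set 'I_n}) (z : 'I_n) : {set {set 'I_n}} :=
  e |: [set [set x; z] | x in e].

Definition block_extensions (n : nat) (b : nat -> nat) (e : {set 'I_n}) : {set 'I_n} :=
  [set z | (z \notin e) && [forall x in e, b x == b z]].

(** Each triangle is counted three times, once per edge, so that the sum bounds the number of edges
    lying in such triangles. *)
Definition num_block_triangles (n : nat) (b : nat -> nat) (G : {set {set 'I_n}}) : nat :=
  \sum_(e in block_pairs n b) \sum_(z in block_extensions b e) (block_triangle e z \subset G).

(** An edge of [G] inside a block that is not triangle-free there has an apex [z], and so adds at
    least one to the triangle sum. *)
Lemma card_triangle_free_edges_ge (n : nat) (b : nat -> nat) (G : {set {set 'I_n}}) :
  #|G :&: block_pairs n b| <= #|triangle_free_edges b G| + num_block_triangles b G.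
Proof.
rewrite -(cardsID (triangle_free_edges b G)) leq_add //.
  by apply: subset_leq_card; apply: subsetIr.
rewrite -sum1_card big_mkcond /num_block_triangles [X in _ <= X]big_mkcond /=.
apply: leq_sum => e _; rewrite in_setD in_setI.
case: (boolP (e \in block_pairs n b)) => [eQ|_]; last by rewrite !andbF.
case: (boolP (e \in G)) => [eG|_]; last by rewrite !andbF.
rewrite !andbT; case: ifP => //.
move: (eQ); rewrite !inE eG => /andP[_ -> /=]; rewrite negbK => /existsP[z /and3P[ze zb zG]].
rewrite (bigD1 z) /=; last by rewrite inE ze.
suff -> : block_triangle e z \subset G by [].
rewrite subUset sub1set eG /=; apply/subsetP => _ /imsetP[x xe ->].
exact: (forall_inP zG).
Qed.

Lemma block_triangle_sub (n : nat) (b : nat -> nat) (e : {set 'I_n}) (z : 'I_n) :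
  e \in block_pairs n b -> z \in block_extensions b e -> block_triangle e z \subset pairs 'I_n.
Proof.
move=> /setIdP[eP _]; rewrite inE => /andP[ze _].
rewrite subUset sub1set eP; apply/subsetP => _ /imsetP[x xe ->].
by rewrite set2_pairs; apply: contraNneq ze => <-.
Qed.

Lemma card_block_triangle (n : nat) (b : nat -> nat) (e : {set 'I_n}) (z : 'I_n) :
  e \in block_pairs n b -> z \in block_extensions b e -> #|block_triangle e z| = 3.
Proof.
rewrite !inE => /andP[/eqP ce _] /andP[ze _]; rewrite cardsU1 card_in_imset ?ce.
  rewrite (_ : e \notin _) //; apply/imsetP => -[x xe eE].
  by move: ze; rewrite eE set22.
move=> x y xe ye /set2_inj[[]//|[xz _]].
by move: ze; rewrite -xz xe.
Qed.

(** The two ends of [e] also lie in the block. The exact [m - 2] matters for blocks of length [2],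
    which must give no triangle at all. *)
Lemma card_block_extensions (n : nat) (b : nat -> nat) (m : nat) (e : {set 'I_n}) :
  (forall k, #|[set i : 'I_n | b i == k]| <= m) ->
  e \in block_pairs n b -> #|block_extensions b e| <= m - 2.
Proof.
move=> hm; rewrite !inE => /andP[/eqP ce eb].
have /card_gt0P[x xe] : 0 < #|e| by rewrite ce.
have dis : [disjoint block_extensions b e & e].
  by apply/pred0P => z /=; rewrite inE; case: (z \in e); rewrite ?andbF.
have sub : block_extensions b e :|: e \subset [set i : 'I_n | b i == b x].
  apply/subsetP => z; rewrite !inE => /orP[/andP[_ /forall_inP/(_ x xe)]|ze].
    by rewrite eq_sym.
  by move/forall_inP/(_ z ze)/forall_inP/(_ x xe): eb.
have := leq_trans (subset_leq_card sub) (hm (b x)).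
have [_ /eqP] := leq_card_setU (block_extensions b e) e.
by rewrite dis ce => /eqP/eqP-> ; lia.
Qed.

(** The first [K] intervals of length [m] are complete, and distinct intervals share no pair. *)
Lemma card_pairs_block (n m K : nat) : 0 < m -> K * m <= n ->
  K * 'C(m, 2) <= #|block_pairs n (fun i => i %/ m)|.
Proof.
move=> m0 Kmn.
pose B (k : 'I_K) := [set i : 'I_n | i %/ m == k].
have cardB k : m <= #|B k|.
  have lt (j : 'I_m) : k * m + j < n.
    by apply: leq_trans Kmn; have := ltn_ord k; have := ltn_ord j; nia.
  rewrite -[X in X <= _]card_ord -cardsT.
  apply: (leq_card_inj_in (f := fun j => Ordinal (lt j))) => [j _|i j _ _ [/addnI/val_inj//]].
  by rewrite inE /= divnMDl // divn_small // addn0.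
apply: (@leq_trans (\sum_(k < K) 'C(#|B k|, 2))).
  by rewrite -[X in X * _]card_ord -sum_nat_const leq_sum // => k _; rewrite leq_bin2l.
(* [f] recovers the interval from a pair inside it; the default [0] is never reached, since [e] has
   two elements. *)
pose f (e : {set 'I_n}) : nat := if [pick x in e] is Some x then x %/ m else 0.
under eq_bigr => k _ do rewrite -cards_draws -sum1_card.
rewrite -sum1_card.
have fE (k : 'I_K) e : e \in [set A : {set 'I_n} | A \subset B k & #|A| == 2] -> f e = k.
  rewrite inE /f => /andP[eB /eqP e2]; case: pickP => [x xe|e0].
    by move/subsetP/(_ x xe): eB; rewrite inE => /eqP.
  by move: e2; rewrite (eq_card0 e0).
rewrite (exchange_big_dep (mem (block_pairs n (fun i => i %/ m)))) /=; last first.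
  move=> k e _; rewrite !inE => /andP[/subsetP eB ->] /=.
  apply/forall_inP => x /eB; rewrite inE => /eqP->.
  by apply/forall_inP => y /eB; rewrite inE => /eqP->.
apply: leq_sum => e _.
have [/forallP no|/forallPn[k]] := boolP [forall k : 'I_K, e \notin [set A : {set 'I_n} | A \subset B k & #|A| == 2]].
  by rewrite big_pred0 // => k; apply/negbTE/no.
rewrite negbK => ek; rewrite (bigD1 k) //= big_pred0 // => j.
apply/negbTE/negP => /andP[ej]; apply/negP; rewrite negbK; apply/eqP/val_inj.
by rewrite /= -(fE k e ek) -(fE j e ej).
Qed.

Lemma card_block_le (n m k : nat) : 0 < m -> #|[set i : 'I_n | i %/ m == k]| <= m.
Proof.
move=> m0; rewrite -[X in _ <= X](card_ord m) -[X in _ <= X]cardsT.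
have lt (i : 'I_n) : i %% m < m by rewrite ltn_mod.
apply: (leq_card_inj_in (f := fun i => Ordinal (lt i))) => // i j.
rewrite !inE => /eqP di /eqP dj [eqm]; apply/val_inj.
by rewrite /= (divn_eq i m) di eqm -dj -divn_eq.
Qed.

(** * Moments in the binomial random graph *)

From mathcomp Require Import all_classical all_reals all_analysis.
From mathcomp Require Import ring lra.
Import Order.TTheory GRing.Theory Num.Theory.
Import numFieldNormedType.Exports.

Section GnpMoments.
Local Open Scope ring_scope.
Context {R : realType} (n : nat) (p : R).
Hypothesis p01 : 0 <= p <= 1.

Definition Gnp_mean (f : {set {set 'I_n}} -> R) : R :=
  \sum_(G : {set {set 'I_n}} | G \subset pairs 'I_n) Gnp_weight p G * f G.

Lemma Gnp_weight_ge0 (G : {set {set 'I_n}}) : 0 <= Gnp_weight p G.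
Proof.
by case/andP: p01 => p0 p1; apply: prodr_ge0 => e _; case: ifP; rewrite ?subr_ge0.
Qed.

Lemma Gnp_probE (E : pred {set {set 'I_n}}) : Gnp_prob p E = Gnp_mean (fun G => (E G)%:R).
Proof.
rewrite /Gnp_prob big_mkcondr; apply: eq_bigr => G _.
by case: (E G); rewrite ?mulr1 ?mulr0.
Qed.

Lemma eq_Gnp_mean (f g : {set {set 'I_n}} -> R) :
  (forall G, f G = g G) -> Gnp_mean f = Gnp_mean g.
Proof. by move=> fg; apply: eq_bigr => G _; rewrite fg. Qed.

Lemma Gnp_mean_sum (I : Type) (r : seq I) (P : pred I) (f : I -> {set {set 'I_n}} -> R) :
  Gnp_mean (fun G => \sum_(i <- r | P i) f i G) = \sum_(i <- r | P i) Gnp_mean (f i).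
Proof. by rewrite exchange_big; apply: eq_bigr => G _; rewrite mulr_sumr. Qed.

Lemma Gnp_meanZ (c : R) (f : {set {set 'I_n}} -> R) :
  Gnp_mean (fun G => c * f G) = c * Gnp_mean f.
Proof. by rewrite mulr_sumr; apply: eq_bigr => G _; rewrite mulrCA. Qed.

Lemma Gnp_meanD (f g : {set {set 'I_n}} -> R) :
  Gnp_mean (fun G => f G + g G) = Gnp_mean f + Gnp_mean g.
Proof. by rewrite -big_split; apply: eq_bigr => G _; rewrite mulrDr. Qed.

Lemma Gnp_mean_le (f g : {set {set 'I_n}} -> R) :
  (forall G : {set {set 'I_n}}, G \subset pairs 'I_n -> f G <= g G) -> Gnp_mean f <= Gnp_mean g.
Proof. by move=> fg; apply: ler_sum => G /fg h; rewrite ler_wpM2l ?Gnp_weight_ge0. Qed.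

(** Expand the product. Outside [P], the values [0] for [F] and [1] for [H] extend it to all of [T]
    and kill the sets not contained in [P]. *)
Lemma sum_prod_subset (T : finType) (P : {set T}) (F H : T -> R) :
  \sum_(G : {set T} | G \subset P) \prod_(e in P) (if e \in G then F e else H e) =
  \prod_(e in P) (F e + H e).
Proof.
pose F' e := if e \in P then F e else 0; pose H' e := if e \in P then H e else 1.
transitivity (\prod_e (F' e + H' e)); last first.
  by rewrite [RHS]big_mkcond; apply: eq_bigr => e _; rewrite /F' /H'; case: ifP; rewrite ?add0r.
rewrite bigA_distr [LHS]big_mkcond; apply: eq_bigr => G _.
case: (boolP (G \subset P)) => [GP|/fintype.subsetPn[e eG eP]].
  rewrite [LHS]big_mkcond; apply: eq_bigr => e _; rewrite /F' /H'.
  by case: (boolP (e \in P)) => // eP; case: ifP => // /(fintype.subsetP GP); rewrite (negbTE eP).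
by rewrite (bigD1 e) //= eG /F' (negbTE eP) mul0r.
Qed.

(** This is the independence of the edges, in the form used for all moments below. *)
Lemma Gnp_mean_prod (h k : {set 'I_n} -> R) :
  Gnp_mean (fun G => \prod_(e in pairs 'I_n) (if e \in G then h e else k e)) =
  \prod_(e in pairs 'I_n) (p * h e + (1 - p) * k e).
Proof.
rewrite -sum_prod_subset; apply: eq_bigr => G _; rewrite -big_split.
by apply: eq_bigr => e _; case: ifP.
Qed.

Lemma prod_if_in (T : finType) (P Q : {set T}) (x : R) :
  Q \subset P -> \prod_(e in P) (if e \in Q then x else 1) = x ^+ #|Q|.
Proof.
move=> QP; rewrite -big_mkcondr (eq_bigl (mem Q)) ?prodr_const // => e /=.
by case: (boolP (e \in Q)) => [/(fintype.subsetP QP)->|_]; rewrite ?andbF.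
Qed.

(** The indicator is a product over all pairs, with factor [0] at each pair of [Q] missing from
    [G]. *)
Lemma Gnp_mean_subset (Q : {set {set 'I_n}}) : Q \subset pairs 'I_n ->
  Gnp_mean (fun G => (Q \subset G)%:R) = p ^+ #|Q|.
Proof.
move=> QP; rewrite -(prod_if_in p QP).
transitivity (Gnp_mean (fun G => \prod_(e in pairs 'I_n)
    (if e \in G then 1 else if e \in Q then 0 else 1))).
  apply: eq_bigr => G GP; congr (_ * _).
  case: (boolP (Q \subset G)) => [QG|/fintype.subsetPn[e eQ eG]].
    rewrite big1 // => e _; case: ifP => // eG.
    by case: ifP => // /(fintype.subsetP QG); rewrite eG.
  by rewrite (bigD1 e) ?(fintype.subsetP QP) //= (negbTE eG) eQ mul0r.
rewrite Gnp_mean_prod; apply: eq_bigr => e _.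
by case: ifP => _; rewrite ?mulr0 ?mulr1 ?addr0 // addrC subrK.
Qed.

Lemma Gnp_mean_disjoint (Q : {set {set 'I_n}}) : Q \subset pairs 'I_n ->
  Gnp_mean (fun G => [disjoint Q & G]%:R) = (1 - p) ^+ #|Q|.
Proof.
move=> QP; rewrite -(prod_if_in (1 - p) QP).
transitivity (Gnp_mean (fun G => \prod_(e in pairs 'I_n)
    (if e \in G then (if e \in Q then 0 else 1) else 1))).
  apply: eq_bigr => G GP; congr (_ * _).
  case: (boolP [disjoint Q & G]) => [dQG|/pred0Pn[e /andP[/= eQ eG]]].
    rewrite big1 // => e _; case: ifP => // eG; case: ifP => // eQ.
    by move/pred0P/(_ e): dQG; rewrite /= eQ eG.
  by rewrite (bigD1 e) ?(fintype.subsetP QP) //= eG eQ mul0r.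
rewrite Gnp_mean_prod; apply: eq_bigr => e _.
by case: ifP => _; rewrite ?mulr0 ?mulr1 ?add0r // addrC subrK.
Qed.

Lemma Gnp_mean1 : Gnp_mean (fun _ => 1) = 1.
Proof.
have := Gnp_mean_subset (finset.sub0set _); rewrite cards0 expr0; apply: etrans.
by apply: eq_bigr => G _; rewrite finset.sub0set.
Qed.

Lemma Gnp_mean_cst (c : R) : Gnp_mean (fun _ => c) = c.
Proof.
rewrite -[RHS]mulr1 -[in RHS]Gnp_mean1 -Gnp_meanZ.
by apply: eq_bigr => G _; rewrite mulr1.
Qed.

Lemma Gnp_prob_le1 (E : pred {set {set 'I_n}}) : Gnp_prob p E <= 1.
Proof. by rewrite Gnp_probE -[leRHS]Gnp_mean1; apply: Gnp_mean_le => G _ /=; rewrite lern1 leq_b1. Qed.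

Lemma Gnp_prob_union (E B1 B2 : pred {set {set 'I_n}}) :
  (forall G : {set {set 'I_n}}, G \subset pairs 'I_n -> ~~ B1 G -> ~~ B2 G -> E G) ->
  1 - (Gnp_prob p B1 + Gnp_prob p B2) <= Gnp_prob p E.
Proof.
move=> h; rewrite lerBlDr !Gnp_probE -!Gnp_meanD -[leLHS]Gnp_mean1.
apply: Gnp_mean_le => G /h /=; rewrite -!natrD ler1n.
by case: (B1 G); case: (B2 G); case: (E G) => //= /(_ isT isT).
Qed.

Lemma Gnp_prob_and (E1 E2 : pred {set {set 'I_n}}) :
  Gnp_prob p E1 + Gnp_prob p E2 - 1 <= Gnp_prob p (fun G => E1 G && E2 G).
Proof.
rewrite lerBlDr !Gnp_probE -[X in _ <= _ + X](Gnp_mean_cst 1) -!Gnp_meanD.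
apply: Gnp_mean_le => G _ /=; rewrite -[X in _ <= _ + X]/(1%:R) -!natrD ler_nat.
by case: (E1 G); case: (E2 G).
Qed.

Lemma Gnp_prob_markov (E : pred {set {set 'I_n}}) (f : {set {set 'I_n}} -> R) (t : R) :
  0 < t -> (forall G : {set {set 'I_n}}, G \subset pairs 'I_n -> 0 <= f G) ->
  (forall G : {set {set 'I_n}}, G \subset pairs 'I_n -> E G -> t <= f G) ->
  Gnp_prob p E <= Gnp_mean f / t.
Proof.
move=> t0 f0 h; rewrite Gnp_probE ler_pdivlMr // mulrC -Gnp_meanZ.
apply: Gnp_mean_le => G GP; case: (boolP (E G)) => [/(h _ GP)|_]; rewrite ?mulr1 // mulr0.
exact: f0.
Qed.

(** Chebyshev: the number of edges of [G] in [Q] is binomial with variance at most its mean. *)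
Lemma Gnp_prob_edges (Q : {set {set 'I_n}}) (t : R) : Q \subset pairs 'I_n -> 0 < t ->
  Gnp_prob p (fun G => t < `|#|G :&: Q|%:R - p * #|Q|%:R|) <= p * #|Q|%:R / t ^+ 2.
Proof.
move=> QP t0; set mu := p * #|Q|%:R.
have cE G : #|G :&: Q|%:R = \sum_(e in Q) ([set e] \subset G)%:R :> R.
  rewrite -sum1_card natr_sum big_mkcond [RHS]big_mkcond; apply: eq_bigr => e _.
  by rewrite inE finset.sub1set; case: (e \in G); case: (e \in Q).
have m1 : Gnp_mean (fun G => #|G :&: Q|%:R) = mu.
  under eq_Gnp_mean => G do rewrite cE.
  rewrite (Gnp_mean_sum (index_enum _) (mem Q)) (eq_bigr (fun _ => p)) => [|e eQ].
    by rewrite sumr_const -mulr_natr.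
  by rewrite Gnp_mean_subset ?cards1 ?expr1 // finset.sub1set (fintype.subsetP QP).
(* For each [e], the diagonal term gives [p] and the others at most [#|Q| * p ^+ 2 = mu * p]. *)
have m2 : Gnp_mean (fun G => #|G :&: Q|%:R ^+ 2) <= mu ^+ 2 + mu.
  under eq_Gnp_mean => G do rewrite cE expr2 mulr_suml.
  rewrite (Gnp_mean_sum (index_enum _) (mem Q)).
  apply: (@le_trans _ _ (\sum_(e in Q) (mu * p + p))); last first.
    rewrite sumr_const -mulr_natr mulrDl /mu; nra.
  apply: ler_sum => e eQ.
  have -> : Gnp_mean (fun G => ([set e] \subset G)%:R * (\sum_(f in Q) ([set f] \subset G)%:R)) =
      \sum_(f in Q) Gnp_mean (fun G => ([set e; f] \subset G)%:R).
    rewrite -(Gnp_mean_sum (index_enum _) (mem Q)); apply: eq_bigr => G _; congr (_ * _).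
    rewrite mulr_sumr; apply: eq_bigr => f _.
    by rewrite finset.subUset -natrM mulnb.
  rewrite (bigD1 e) //= finset.setUid Gnp_mean_subset ?finset.sub1set ?(fintype.subsetP QP) // cards1 expr1 addrC lerD2r.
  rewrite (eq_bigr (fun _ => p ^+ 2)) => [|f /andP[fQ fe]]; last first.
    rewrite Gnp_mean_subset ?cards2 1?eq_sym ?fe //.
    by rewrite finset.subUset !finset.sub1set !(fintype.subsetP QP).
  rewrite sumr_const -mulr_natr /mu [leRHS]mulrAC -[_ * p]expr2 ler_wpM2l ?sqr_ge0 // ler_nat.
  by apply/subset_leq_card/fintype.subsetP => f /andP[].
apply: le_trans (Gnp_prob_markov (f := fun G => (#|G :&: Q|%:R - mu) ^+ 2) (t := t ^+ 2) _ _ _) _.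
- by rewrite exprn_gt0.
- by move=> G _; rewrite sqr_ge0.
- by move=> G _ /ltW h; rewrite -[leRHS]real_normK ?num_real // ler_sqr ?nnegrE // ltW.
rewrite ler_wpM2r ?invr_ge0 ?sqr_ge0 //.
have -> : Gnp_mean (fun G => (#|G :&: Q|%:R - mu) ^+ 2) =
    Gnp_mean (fun G => #|G :&: Q|%:R ^+ 2) + ((- 2 * mu) * Gnp_mean (fun G => #|G :&: Q|%:R) + mu ^+ 2).
  rewrite -(Gnp_mean_cst (mu ^+ 2)) -Gnp_meanZ -!Gnp_meanD.
  by apply: eq_bigr => G _; congr (_ * _); ring.
rewrite m1; nra.
Qed.

(** Markov: each pair in a block has at most [m - 2] apexes, and each triangle is present with
    probability [p ^+ 3]. *)
Lemma Gnp_prob_block_triangles (b : nat -> nat) (m : nat) (t : R) :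
  (forall k, #|[set i : 'I_n | b i == k]| <= m)%N -> 0 < t ->
  Gnp_prob p (fun G : {set {set 'I_n}} => t < (num_block_triangles b G)%:R) <=
    p ^+ 3 * #|block_pairs n b|%:R * (m - 2)%:R / t.
Proof.
move=> hm t0; case/andP: p01 => p0 _.
apply: le_trans (Gnp_prob_markov (f := fun G => (num_block_triangles b G)%:R) t0 _ _) _ => //.
  by move=> G _ /ltW.
rewrite ler_wpM2r ?invr_ge0 ?(ltW t0) //.
under eq_Gnp_mean => G do rewrite natr_sum.
rewrite (Gnp_mean_sum (index_enum _) (mem (block_pairs n b))).
rewrite [leRHS]mulrAC [leRHS]mulr_natr -sumr_const.
rewrite ler_sum // => e eQ.
have -> : Gnp_mean (fun G => (\sum_(z in block_extensions b e) (block_triangle e z \subset G))%:R) =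
    \sum_(z in block_extensions b e) Gnp_mean (fun G => (block_triangle e z \subset G)%:R).
  rewrite -(Gnp_mean_sum (index_enum _) (mem (block_extensions b e))).
  by apply: eq_bigr => G _; rewrite natr_sum.
rewrite (eq_bigr (fun _ => p ^+ 3)) => [|z zE].
  by rewrite sumr_const -[leLHS]mulr_natr ler_wpM2l ?exprn_ge0 // ler_nat card_block_extensions.
by rewrite Gnp_mean_subset ?(card_block_triangle eQ zE) // (block_triangle_sub eQ zE).
Qed.

(** Union bound over the vertex sets of size [a], of which there are at most [n ^ a]. *)
Lemma Gnp_prob_independent (a : nat) :
  Gnp_prob p (fun G => [exists I : {set 'I_n}, (#|I| == a) &&
      [disjoint [set e : {set 'I_n} | e \subset I & #|e| == 2%N] & G]]) <=
    n%:R ^+ a * (1 - p) ^+ 'C(a, 2).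
Proof.
case/andP: p01 => p0 p1.
apply: (@le_trans _ _ (Gnp_mean (fun G => \sum_(I : {set 'I_n} | #|I| == a)
    [disjoint [set e : {set 'I_n} | e \subset I & #|e| == 2%N] & G]%:R))).
  rewrite Gnp_probE; apply: Gnp_mean_le => G _.
  case: existsP => [[I /andP[Ia dI]]|_]; last exact: sumr_ge0.
  by rewrite (bigD1 I) //= dI lerDl sumr_ge0.
rewrite Gnp_mean_sum (eq_bigr (fun _ => (1 - p) ^+ 'C(a, 2))) => [|I /eqP Ia]; last first.
  rewrite Gnp_mean_disjoint ?cards_draws ?Ia //.
  by apply/fintype.subsetP => e; rewrite !inE => /andP[].
rewrite sumr_const -[leLHS]mulr_natl ler_wpM2r ?exprn_ge0 ?subr_ge0 //.
have -> : #|[pred I : {set 'I_n} | #|I| == a]| = 'C(n, a).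
  by rewrite -[in RHS](card_ord n) -card_draws; apply: eq_card => I; rewrite !inE.
rewrite -natrX ler_nat.
apply: (@leq_trans (n ^_ a)); first by rewrite -bin_ffact leq_pmulr // fact_gt0.
by rewrite ffact_prod -[X in (_ <= _ ^ X)%N]card_ord -prod_nat_const leq_prod // => i _; apply: leq_subr.
Qed.

End GnpMoments.

(** * Bounds for fixed [n], and the limit *)

Section LogCount.
Local Open Scope ring_scope.
Context {R : realType}.

(** This is [ln (1 + x) <= x] at [x = - 1/2]. *)
Lemma ln2_ge : 2^-1 <= ln 2 :> R.
Proof.
have /(le_ln1Dx (R := R)) : -1 < - 2^-1 :> R by lra.
by rewrite (_ : 1 + - 2^-1 = 2^-1) ?lnV ?posrE; lra.
Qed.

Lemma ln2_gt0 : 0 < ln 2 :> R.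
Proof. by have := ln2_ge; lra. Qed.

Lemma log2_exp (k : nat) : log2 (2 ^ k)%:R = k%:R :> R.
Proof.
rewrite /log2 natrX lnXn // mulrnAl divff //; exact/lt0r_neq0/ln2_gt0.
Qed.

Lemma log2_le (a b : nat) : (0 < a)%N -> (a <= b)%N -> log2 a%:R <= log2 b%:R :> R.
Proof.
move=> a0 ab; rewrite ler_pM2r ?invr_gt0 ?ln2_gt0 // ler_ln ?posrE ?ltr0n ?ler_nat //.
exact: leq_trans ab.
Qed.

Lemma log2_num_free_ge (n : nat) (b : nat -> nat) (G : {set {set 'I_n}}) :
  {homo b : i j / (i <= j)%N} -> G \subset pairs 'I_n ->
  #|G :&: block_pairs n b|%:R - (num_block_triangles b G)%:R <=
    log2 (num_free_orientations G (dcycle 3))%:R :> R.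
Proof.
move=> mono_b Gp; apply: (@le_trans _ _ #|triangle_free_edges b G|%:R).
  by rewrite lerBlDr -natrD ler_nat card_triangle_free_edges_ge.
rewrite -[leLHS]log2_exp log2_le ?expn_gt0 // num_free_dcycle3E //.
exact: card_transitive_orientations_ge.
Qed.

Lemma log2_num_free_le_card (n : nat) (G : {set {set 'I_n}}) : G \subset pairs 'I_n ->
  log2 (num_free_orientations G (dcycle 3))%:R <= #|G|%:R :> R.
Proof.
move=> Gp; rewrite -[leRHS]log2_exp num_free_dcycle3E // log2_le //.
  (* The lower bound, here with [b := id], shows that the count is positive, as [log2_le]
     requires. *)
  apply: leq_trans (card_transitive_orientations_ge (b := id) _ Gp); first by rewrite expn_gt0.
  by [].
exact: (card_transitive_orientations_le_exp (rk := id)).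
Qed.

End LogCount.

(** * Probability bounds for fixed [n] *)

Section FiniteBounds.
Local Open Scope ring_scope.
Context {R : realType}.

Lemma natr_bin2 (k : nat) : 'C(k, 2)%:R = k%:R * (k%:R - 1) / 2 :> R.
Proof.
apply: (@mulIf _ 2); rewrite ?pnatr_eq0 // divfK ?pnatr_eq0 //.
rewrite -natrM (bin_ffact k 2) ffactnS ffactn1; case: k => [|k]; first by rewrite !mul0r.
by rewrite natrM /= -natr1 addrK.
Qed.

(** A constant [b] makes one block of all vertices. The logarithm lies between [#|G|] minus the
    triangle sum and [#|G|]; the two error terms come from Chebyshev and Markov, each with deviation
    [eps * mu / 2]. *)
Lemma Gnp_prob_log2_num_free_sparse (n : nat) (p eps : R) : (2 <= n)%N -> 0 < p <= 1 -> 0 < eps ->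
  1 - (16 / (eps ^+ 2 * (p * n%:R ^+ 2)) + 2 * p ^+ 2 * n%:R / eps) <=
  Gnp_prob p (fun G : {set {set 'I_n}} =>
    `|log2 (num_free_orientations G (dcycle 3))%:R - p * 'C(n, 2)%:R| <= eps * (p * 'C(n, 2)%:R)).
Proof.
move=> n2 /andP[p0 p1] eps0; have p01 : 0 <= p <= 1 by rewrite ltW.
have Qall : block_pairs n (fun _ => 0%N) = pairs 'I_n.
  apply/setP => e; rewrite inE andbC; case: (boolP [forall _ in _, _]) => // /negP[].
  by apply/forall_inP => x _; apply/forall_inP.
have cQ : #|pairs 'I_n| = 'C(n, 2) by rewrite -[in RHS](card_ord n) -card_draws.
have nR : 2 <= n%:R :> R by rewrite ler_nat.
set mu := p * 'C(n, 2)%:R; have muE : mu = p * (n%:R * (n%:R - 1) / 2) by rewrite /mu natr_bin2.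
have mu_ge : p * n%:R ^+ 2 / 4 <= mu.
  have : 0 <= p * n%:R * (n%:R - 2) by rewrite !mulr_ge0 ?(ltW p0) ?subr_ge0 //; lra.
  by rewrite muE; lra.
have pn0 : 0 < p * n%:R ^+ 2 by rewrite mulr_gt0 // exprn_gt0 //; lra.
have mu0 : 0 < mu by lra.
pose t := eps * mu / 2; have t0 : 0 < t by rewrite divr_gt0 // mulr_gt0.
have P1 := Gnp_prob_edges p01 (subxx (pairs 'I_n)) t0.
have hm k : (#|[set i : 'I_n | 0%N == k]| <= n)%N by apply: leq_trans (max_card _) _; rewrite card_ord.
have P2 := Gnp_prob_block_triangles p01 (b := fun _ => 0%N) hm t0.
rewrite cQ -/mu in P1; rewrite Qall cQ in P2.
have b1 : mu / t ^+ 2 <= 16 / (eps ^+ 2 * (p * n%:R ^+ 2)).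
  rewrite (_ : mu / t ^+ 2 = 4 / (eps ^+ 2 * mu)); last by rewrite /t; field; rewrite !gt_eqF.
  have epsmu : 0 < eps ^+ 2 * mu by apply: mulr_gt0 => //; apply: exprn_gt0.
  have epspn : 0 < eps ^+ 2 * (p * n%:R ^+ 2) by apply: mulr_gt0 => //; apply: exprn_gt0.
  rewrite ler_pdivrMr // mulrAC ler_pdivlMr //.
  have := ler_wpM2l (sqr_ge0 eps) mu_ge; lra.
have b2 : p ^+ 3 * 'C(n, 2)%:R * (n - 2)%:R / t <= 2 * p ^+ 2 * n%:R / eps.
  rewrite (_ : p ^+ 3 * _ = p ^+ 2 * mu); last by rewrite /mu; ring.
  rewrite (_ : _ / t = 2 * p ^+ 2 * (n - 2)%:R / eps); last by rewrite /t; field; rewrite !gt_eqF.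
  have c0 : 0 <= 2 * p ^+ 2 by have := sqr_ge0 p; lra.
  by rewrite ler_wpM2r ?invr_ge0 ?(ltW eps0) // ler_wpM2l // ler_nat leq_subr.
apply: le_trans (Gnp_prob_union p01 (B1 := fun G => t < `|#|G :&: pairs 'I_n|%:R - mu|)
  (B2 := fun G => t < (num_block_triangles (fun _ => 0%N) G)%:R) _); first lra.
move=> G GP; rewrite -!leNgt => e1 e2.
have lo := @log2_num_free_ge R n (fun _ => 0%N) G (fun _ _ _ => leqnn _) GP.
have up := @log2_num_free_le_card R n G GP.
move: lo; rewrite Qall; move: e1; rewrite (finset.setIidPl GP) => /ler_normlP[e1 e1'] lo.
have tE : 2 * t = eps * mu by rewrite /t; field.
by apply/ler_normlP; split; lra.
Qed.

Lemma log2_num_free_le (n a : nat) (G : {set {set 'I_n}}) :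
  G \subset pairs 'I_n -> (0 < a)%N -> (0 < n)%N ->
  ~~ [exists I : {set 'I_n}, (#|I| == a) &&
      [disjoint [set e : {set 'I_n} | e \subset I & #|e| == 2%N] & G]] ->
  log2 (num_free_orientations G (dcycle 3))%:R <= (4 * a * n)%:R * log2 (2 * n)%:R :> R.
Proof.
move=> Gp a0 n0 /existsPn noindep.
have hI (I : {set 'I_n}) : (a <= #|I|)%N ->
    exists x y, [/\ x \in I, y \in I & [set x; y] \in G].
  move=> aI.
  (* The union bound concerns sets of size exactly [a]; a larger set contains one of these. *)
  have : (0 < #|[set J : {set 'I_n} | J \subset I & #|J| == a]|)%N by rewrite cards_draws bin_gt0.
  case/card_gt0P => J; rewrite inE => /andP[JI Ja].
  have := noindep J; rewrite Ja => /pred0Pn[e /andP[]] /=; rewrite inE => /andP[eJ /cards2P[x [y [_ eE]]]] eG.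
  exists x, y; rewrite -eE; split => //; apply: (fintype.subsetP JI); apply: (fintype.subsetP eJ);
    by rewrite eE !inE eqxx ?orbT.
rewrite num_free_dcycle3E //.
have := card_transitive_orientations_le [set: 'I_n] Gp a0 hI; rewrite cardsT card_ord => le.
have pos : (0 < #|transitive_orientations G [set: 'I_n]|)%N.
  apply: leq_trans (card_transitive_orientations_ge (b := id) _ Gp); first by rewrite expn_gt0.
  by [].
apply: le_trans (log2_le pos le) _.
by rewrite /log2 natrX lnXn ?ltr0n ?muln_gt0 // -[_ *+ _]mulr_natl mulrA.
Qed.

(** With [a] about [4 * L / p], the failure probability is at most
    [exp (a * L - 2 * a * L) <= exp (- L)], and the exponent is at most [72 * L ^+ 2 * n / p]. The
    hypothesis [72 <= L] absorbs the constant into a third logarithm. *)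
Lemma Gnp_prob_log2_num_free_le (n : nat) (p : R) : 0 < p <= 1 -> 72 <= ln n%:R :> R ->
  1 - 1 / ln n%:R <= Gnp_prob p (fun G : {set {set 'I_n}} =>
    log2 (num_free_orientations G (dcycle 3))%:R <= n%:R / p * ln n%:R ^+ 3).
Proof.
move=> /andP[p0 p1] hL; have p01 : 0 <= p <= 1 by rewrite ltW.
set L : R := ln n%:R in hL *; have L0 : 0 < L by lra.
(* [ln 0] is [0] by convention, so a positive logarithm excludes [n = 0]. *)
have n0 : (0 < n)%N.
  by case: n @L hL L0 => // L hL; rewrite /L ln0 // ltxx.
have nR : 0 < n%:R :> R by rewrite ltr0n.
have expL : expR L = n%:R by rewrite lnK.
have [a [a0 a_ge a_le]] : exists a : nat,
    [/\ (0 < a)%N, 4 * L <= p * (a%:R - 1) & a%:R <= 6 * L / p].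
  have /truncn_itv : 0 <= 4 * L / p by rewrite divr_ge0 ?mulr_ge0 // ltW.
  set k := Num.truncn _ => /andP[k_le k_gt]; exists k.+2; split=> //.
    by rewrite -(natr1 k.+1) addrK [leRHS]mulrC -ler_pdivrMr // ltW.
  have : 2 <= 2 * L / p by rewrite ler_pdivlMr //; nra.
  by rewrite -addn2 natrD; lra.
have a1 : 1 <= a%:R :> R by rewrite ler1n.
have bad := @Gnp_prob_independent R n p p01 a.
have small : n%:R ^+ a * (1 - p) ^+ 'C(a, 2) <= 1 / L.
  apply: (@le_trans _ _ (expR (- L))).
    apply: (@le_trans _ _ (expR (a%:R * L) * expR ('C(a, 2)%:R * - p))).
      rewrite !expRM_natl expL ler_wpM2l ?exprn_ge0 ?ler0n // lerXn2r ?nnegrE ?expR_ge0 ?subr_ge0 //.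
      exact: expR_ge1Dx.
    rewrite -expRD ler_expR natr_bin2.
    have := ler_wpM2l (ler0n R a) a_ge; have := ler_wpM2r (ltW L0) a1; lra.
  rewrite expRN div1r lef_pV2 ?posrE ?expR_gt0 //.
  by apply: le_trans (expR_ge1Dx L); rewrite lerDr.
have log2n : log2 (2 * n)%:R <= 3 * L.
  rewrite /log2 natrM lnM ?posrE // ler_pdivrMr ?ln2_gt0 // -/L.
  have := ln2_ge (R := R); nra.
(* There is a single bad event; the second one is taken empty. *)
apply: le_trans (Gnp_prob_union p01 (B1 := fun G => [exists I : {set 'I_n}, (#|I| == a) &&
      [disjoint [set e : {set 'I_n} | e \subset I & #|e| == 2%N] & G]]) (B2 := pred0) _).
  rewrite lerD2l lerN2; have -> : Gnp_prob p (pred0 : pred {set {set 'I_n}}) = 0.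
    by rewrite /Gnp_prob big_pred0 // => G; rewrite andbF.
  by rewrite addr0; apply: le_trans bad small.
move=> G GP no _; apply: le_trans (log2_num_free_le GP a0 n0 no) _ => //.
apply: (@le_trans _ _ ((4 * (6 * L / p) * n%:R) * (3 * L))).
  rewrite ler_pM // ?ler0n //.
    by rewrite divr_ge0 ?(ltW ln2_gt0) // ln_ge0 // ler1n muln_gt0.
  by rewrite !natrM ler_wpM2r ?ler0n // ler_wpM2l.
have -> : 4 * (6 * L / p) * n%:R * (3 * L) = n%:R / p * (72 * L ^+ 2) by field; rewrite gt_eqF.
rewrite ler_wpM2l ?divr_ge0 ?ler0n ?(ltW p0) // exprS ler_wpM2r ?sqr_ge0 //.
Qed.

(** Of the error, [1024 / L] comes from Chebyshev for the edges inside blocks and [4 / L] from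
    Markov for the triangles. *)
Lemma Gnp_prob_log2_num_free_ge (n : nat) (p : R) :
  0 < p <= 1 -> 6 <= ln n%:R :> R -> 1 <= n%:R * p ^+ 2 ->
  1 - 1028 / ln n%:R <= Gnp_prob p (fun G : {set {set 'I_n}} =>
    n%:R / p / ln n%:R ^+ 3 <= log2 (num_free_orientations G (dcycle 3))%:R).
Proof.
move=> /andP[p0 p1] hL np2; have p01 : 0 <= p <= 1 by rewrite ltW.
set L : R := ln n%:R in hL *; have L0 : 0 < L by lra.
have n0 : (0 < n)%N.
  by case: n @L hL L0 np2 => // L hL; rewrite /L ln0 // ltxx.
have nR : 0 < n%:R :> R by rewrite ltr0n.
have expL : expR L = n%:R by rewrite lnK.
(* It serves to bound the Chebyshev error [16 / mu] by [1024 / L]. *)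
have L2n : L ^+ 2 <= 4 * n%:R.
  have -> : n%:R = expR (L / 2) ^+ 2 by rewrite -expRM_natl -expL; congr expR; field.
  have := expR_ge1Dx (L / 2); nra.
have n_ge7 : 7 <= n%:R :> R by rewrite -expL; apply: le_trans (expR_ge1Dx L); lra.
have n2 : (2 <= n)%N by rewrite -(ler_nat R); lra.
pose x := (p ^+ 2 * L)^-1; have p2L : 0 < p ^+ 2 * L by rewrite mulr_gt0 ?exprn_gt0.
have x0 : 0 < x by rewrite invr_gt0.
have xE : x * (p ^+ 2 * L) = 1 by rewrite mulVf ?gt_eqF.
have xn : x <= n%:R.
  rewrite -(ler_pM2r p2L) xE mulrA; apply: (le_trans np2).
  have L_ge1 : 1 <= L by lra.
  by have := ler_wpM2l (le_trans ler01 np2) L_ge1; rewrite mulr1.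
(* [m] is [x] rounded down, but at least [2]. For large [p], where [x] is small, the blocks are
   pairs and [m - 2] vanishes, so the upper bound by [x] survives. *)
have [m [m2 mn m_gex m_lex]] : exists m : nat,
    [/\ (2 <= m)%N, (m <= n)%N, x / 2 <= m%:R & (m - 2)%:R <= x].
  have /andP[] := truncn_itv (ltW x0); set k := Num.truncn x => k_le k_gt.
  have [k2|k2] := leqP k 2.
    exists 2%N; split=> //; last by rewrite subnn ltW.
    have : k.+1%:R <= 3 :> R by rewrite ler_nat.
    lra.
  exists k; split; [exact: ltnW| |rewrite -natr1 in k_gt|].
  - by rewrite -(ler_nat R) (le_trans k_le).
  - have : 3 <= k%:R :> R by rewrite ler_nat.
    lra.
  - by rewrite (le_trans _ k_le) // ler_nat leq_subr.
have m0 : (0 < m)%N by apply: leq_trans m2.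
have m2R : 2 <= m%:R :> R by rewrite ler_nat.
have [K [Kmn Kge]] : exists K : nat, (K * m <= n)%N /\ n%:R <= 2 * (K%:R * m%:R) :> R.
  exists (n %/ m)%N; split; first exact: leq_divM.
  have K0 : (0 < n %/ m)%N by rewrite divn_gt0.
  rewrite -!natrM ler_nat (leq_trans (ltnW (ltn_ceil n m0))) //.
  by rewrite mulSn mul2n -addnn leq_add2r leq_pmull.
pose b := fun i : nat => (i %/ m)%N.
have mono_b : {homo b : i j / (i <= j)%N} by move=> i j; apply: leq_div2r.
have hm k : (#|[set i : 'I_n | b i == k]| <= m)%N by exact: card_block_le.
set Q := block_pairs n b; have QP : Q \subset pairs 'I_n.
  by apply/fintype.subsetP => e /setIdP[].
(* One factor [2] is lost in each of [m - 1 >= m / 2], the binomial coefficient, and the incomplete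
   last interval. *)
have q_ge : n%:R * m%:R / 8 <= #|Q|%:R :> R.
  have : (K * 'C(m, 2))%:R <= #|Q|%:R :> R by rewrite ler_nat card_pairs_block.
  rewrite natrM natr_bin2; apply: le_trans.
  have h : 0 <= m%:R * (m%:R - 2) :> R by rewrite mulr_ge0 ?ler0n //; lra.
  have := ler_wpM2l (ler0n R K) h; have := ler_wpM2r (ler0n R m) Kge; lra.
set mu := p * #|Q|%:R.
have mu_ge : n%:R / (16 * p * L) <= mu.
  rewrite (_ : n%:R / (16 * p * L) = p * (n%:R * (x / 2) / 8)); last first.
    by rewrite /x; field; rewrite !gt_eqF.
  rewrite ler_wpM2l ?(ltW p0) //; apply: le_trans q_ge.
  by rewrite ler_pM2r ?invr_gt0 // ler_wpM2l // ltW.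
have mu0 : 0 < mu by apply: lt_le_trans mu_ge; rewrite divr_gt0 ?mulr_gt0.
pose t := mu / 4; have t0 : 0 < t by rewrite divr_gt0.
have P1 := Gnp_prob_edges p01 QP t0; rewrite -/mu in P1.
have P2 := Gnp_prob_block_triangles p01 hm t0; rewrite -/Q in P2.
have b1 : mu / t ^+ 2 <= 1024 / L.
  rewrite (_ : mu / t ^+ 2 = 16 / mu); last by rewrite /t; field; rewrite gt_eqF.
  rewrite ler_pdivrMr // mulrAC ler_pdivlMr //.
  apply: (@le_trans _ _ (1024 * (n%:R / (16 * p * L)))); last first.
    by rewrite ler_wpM2l ?ler0n.
  have pL2 := ler_wpM2r (sqr_ge0 L) p1.
  rewrite mulrA ler_pdivlMr ?mulr_gt0 //.
  by move: pL2 L2n; clear; lra.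
have b2 : p ^+ 3 * #|Q|%:R * (m - 2)%:R / t <= 4 / L.
  rewrite (_ : p ^+ 3 * _ = p ^+ 2 * mu); last by rewrite /mu; ring.
  rewrite (_ : _ / t = 4 * (p ^+ 2 * (m - 2)%:R)); last by rewrite /t; field; rewrite gt_eqF.
  rewrite ler_wpM2l // (_ : L^-1 = p ^+ 2 * x) ?ler_wpM2l ?sqr_ge0 //.
  by rewrite /x; field; rewrite !gt_eqF.
apply: le_trans (Gnp_prob_union p01 (B1 := fun G => t < `|#|G :&: Q|%:R - mu|)
  (B2 := fun G => t < (num_block_triangles b G)%:R) _); first lra.
move=> G GP; rewrite -!leNgt => /ler_normlP[e1 e1'] e2.
have lo := @log2_num_free_ge R n b G mono_b GP.
apply: (@le_trans _ _ (mu / 2)); last by move: e1 e2 lo; rewrite -/Q /t; lra.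
apply: (@le_trans _ _ (n%:R / (16 * p * L) / 2)); last by rewrite ler_pM2r ?invr_gt0.
rewrite -[leLHS]mulrA -invfM -[leRHS]mulrA -invfM ler_wpM2l ?(ltW nR) //.
rewrite lef_pV2 ?posrE ?mulr_gt0 ?exprn_gt0 //.
(* The accumulated loss is [32 * L], and [L >= 6]. *)
have : 36 * L <= L ^+ 3 by rewrite exprSr ler_wpM2r ?(ltW L0) //; nra.
move=> h; have := ler_wpM2l (ltW p0) h; have := mulr_gt0 p0 L0; lra.
Qed.

End FiniteBounds.

(** * Passage to the limit *)

Section WithHighProbability.
Local Open Scope ring_scope.
Local Open Scope classical_set_scope.
Context {R : realType} (p : nat -> R).
Hypothesis hp : forall n, 0 < p n <= 1.

(** Probabilities never exceed [1], so convergence to [1] needs lower bounds only. *)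
Lemma whp_near (E : forall n, pred {set {set 'I_n}}) :
  (forall e, 0 < e -> \forall n \near \oo, 1 - e <= Gnp_prob (p n) (E n)) -> whp p E.
Proof.
move=> h; apply/cvgrPdist_le => e e0; near=> n.
have p01 : 0 <= p n <= 1 by case/andP: (hp n) => /ltW->.
rewrite ger0_norm ?subr_ge0 ?Gnp_prob_le1 // lerBlDr addrC -lerBlDr.
by near: n; apply: h.
Unshelve. all: by end_near. Qed.

Lemma much_less_le (f g : nat -> R) (e : R) : much_less f g -> 0 < e ->
  \forall n \near \oo, f n / g n <= e.
Proof. by move=> fg e0; apply: (cvgr_le 0). Qed.

Lemma ln_natr_near (M : R) : \forall n \near \oo, M <= ln n%:R :> R.
Proof.
near=> n; have h : expR M <= n%:R by near: n; apply: nbhs_infty_ger.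
by rewrite -[M]expRK ler_ln ?posrE ?expR_gt0 // (lt_le_trans _ h) ?expR_gt0.
Unshelve. all: by end_near. Qed.

End WithHighProbability.

Unset Implicit Arguments.
Local Open Scope ring_scope.

Theorem theorem1p2 (R : realType) (p : nat -> R)
    (hp : forall n : nat, 0 < p n <= 1) :
  let X := fun (n : nat) (G : {set {set 'I_n}}) =>
    log2 (num_free_orientations G (dcycle 3))%:R : R in
  (much_less (fun n => n%:R `^ (- 2)) p ->
   much_less p (fun n => n%:R `^ (- 2^-1)) ->
   whp_asymp p X (fun n => p n * 'C(n, 2)%:R))
  /\
  (much_less (fun n => n%:R `^ (- 2^-1)) p ->
   whp_polylog p X (fun n => n%:R / p n)).
Proof.
move=> X; split.
  move=> h1 h2 eps eps0; apply: (whp_near hp) => e e0.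
  (* The two thresholds are chosen so that each error term of the sparse bound is at most
     [e / 2]. *)
  have e1 : 0 < e / 2 * eps ^+ 2 / 16 by rewrite !mulr_gt0 ?exprn_gt0 ?invr_gt0.
  have e2 : 0 < Num.sqrt (e * eps / 4) by rewrite sqrtr_gt0 !mulr_gt0 ?invr_gt0.
  near=> n.
  case/andP: (hp n) => p0 p1.
  have n2 : (2 <= n)%N by near: n; apply: nbhs_infty_ge.
  have n0 : 0 < n%:R :> R by rewrite ltr0n; apply: leq_trans n2.
  have : n%:R `^ (- 2) / p n <= e / 2 * eps ^+ 2 / 16 by near: n; apply: (much_less_le h1).
  have : p n / n%:R `^ (- 2^-1) <= Num.sqrt (e * eps / 4) by near: n; apply: (much_less_le h2).
  rewrite !powRN powR12_sqrt ?(ltW n0) // powR_mulrn ?(ltW n0) // invrK => d2 d1.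
  apply: le_trans (Gnp_prob_log2_num_free_sparse n2 (hp n) eps0).
  have {}d2 : p n ^+ 2 * n%:R <= e * eps / 4.
    rewrite -[e * _ / 4]sqr_sqrtr; last by rewrite !mulr_ge0 ?invr_ge0 ?ltW.
    rewrite -[n%:R]sqr_sqrtr ?(ltW n0) // -exprMn lerXn2r ?nnegrE ?mulr_ge0 ?sqrtr_ge0 ?(ltW p0) //.
  have {}d2 : 2 * p n ^+ 2 * n%:R / eps <= e / 2 by rewrite ler_pdivrMr //; lra.
  have {}d1 : 16 / (eps ^+ 2 * (p n * n%:R ^+ 2)) <= e / 2.
    rewrite (_ : _ / _ = 16 / eps ^+ 2 * ((n%:R ^+ 2)^-1 / p n)); last first.
      by field; rewrite !gt_eqF.
    rewrite [leLHS]mulrC -ler_pdivlMr ?divr_gt0 ?exprn_gt0 //.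
    by apply: (le_trans d1); rewrite invf_div [leRHS]mulrA.
  lra.
move=> h; exists 3.
apply: (whp_near hp) => e e0; near=> n.
case/andP: (hp n) => p0 p1; have p01 : 0 <= p n <= 1 by rewrite ltW.
have L1 : 72 <= ln n%:R :> R by near: n; apply: ln_natr_near.
(* [1029] adds the error [1028] of the lower bound and [1] of the upper bound. *)
have L2 : 1029 / e <= ln n%:R by near: n; apply: ln_natr_near.
have n0 : 0 < n%:R :> R by rewrite ltr0n; near: n; apply: nbhs_infty_ge.
have : n%:R `^ (- 2^-1) / p n <= 1 by near: n; apply: (much_less_le h).
rewrite powRN powR12_sqrt ?(ltW n0) // ler_pdivrMr // mul1r => sqle.
have s0 : 0 < Num.sqrt n%:R :> R by rewrite sqrtr_gt0.
have np2 : 1 <= n%:R * p n ^+ 2.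
  have : 1 <= Num.sqrt n%:R * p n by rewrite mulrC -ler_pdivrMr // div1r.
  move/(exprn_ege1 2); rewrite exprMn sqr_sqrtr //; exact: ltW.
rewrite powR_mulrn ?(le_trans _ L1) //.
have L6 : 6 <= ln n%:R :> R by lra.
have lo := Gnp_prob_log2_num_free_ge (hp n) L6 np2.
have up := Gnp_prob_log2_num_free_le (hp n) L1.
have eL : 1028 / ln n%:R + 1 / ln n%:R <= e.
  rewrite -mulrDl natr1 ler_pdivrMr; last by lra.
  by rewrite mulrC -ler_pdivrMr.
apply: le_trans (Gnp_prob_and p01 _ _); move: lo up eL; rewrite /X.
set A := Gnp_prob _ _; set B := Gnp_prob _ _ => lo up eL.
lra.
Unshelve. all: by end_near.
Qed.
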